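(* Let $\varphi:(Q\times Q)/G\to\tilde{G}$ be a splitting of the discrete Atiyah sequence, i.e. a map of bundles over $S$ with $\varphi\circ i=1_{\tilde{G}}$. Define $\mathcal{A}_d:Q\times Q\to G$ as follows. In a local trivialization write $q_0=(x_0,g_0)$, $q_1=(x_1,g_1)$, and let $\tilde{g}\in G$ be the unique element such that $((x_0,e),\tilde{g})\in Q\times G$ belongs to the class $\varphi([q_0,q_1]_G)=\varphi([(x_0,e),(x_1,g_0^{-1}g_1)]_G)$, viewed as a subset of $Q\times G$. Set $$\mathcal{A}_d\big((x_0,e),(x_1,g_0^{-1}g_1)\big)=\tilde{g},\qquad \mathcal{A}_d\big((x_0,g_0),(x_1,g_1)\big)=g_0\tilde{g}g_0^{-1}.$$ Then $\mathcal{A}_d$ is a discrete connection $1$-form with the requisite properties: $\mathcal{A}_d(gq_0,gq_1)=g\,\mathcal{A}_d(q_0,q_1)\,g^{-1}$ and $\mathcal{A}_d(q_0,gq_0)=g$ for all $g\in G$ and $q_0,q_1\in Q$.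
   Context: $Q$ is a smooth manifold with a free smooth left action $(g,q)\mapsto gq$ of a Lie group $G$ such that the projection $\pi:Q\to S=Q/G$ is a submersion; $e$ is the identity of $G$. $G$ acts on $Q\times Q$ diagonally, and $\tilde{G}=(Q\times G)/G$ for the action $k(q,g)=(kq,kgk^{-1})$; classes are denoted $[\cdot,\cdot]_G$. These are bundles over $S$ via $[q_0,q_1]_G\mapsto\pi(q_0)$ and $[q,g]_G\mapsto\pi(q)$. The discrete Atiyah sequence is $0\to\tilde{G}\xrightarrow{\,i\,}(Q\times Q)/G\xrightarrow{(\pi,\pi)}S\times S\to0$, with $i([q,g]_G)=[q,gq]_G$ and $(\pi,\pi)([q_0,q_1]_G)=(\pi q_0,\pi q_1)$. A local trivialization identifies points of $Q$ lying over neighborhoods of the base points in question with pairs $(x,g)$, $x\in S$, $g\in G$, so that $\pi(x,g)=x$ and $k(x,g)=(x,kg)$ for $k\in G$. *)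

(* Defs.v *)
From HB Require Import structures.
From mathcomp Require Import all_boot all_order all_algebra.
From mathcomp Require Import all_classical all_reals all_analysis.
Import numFieldNormedType.Exports.
Set Implicit Arguments.
Unset Strict Implicit.
Unset Printing Implicit Defensive.
Import Order.TTheory GRing.Theory Num.Theory.
Local Open Scope classical_set_scope.
Local Open Scope ring_scope.

(* MathComp-Analysis has no manifolds: they are set up here, over an arbitrary
   [R : realType], by atlases on a bare type, the topology being the one induced
   by the charts.  Dimension 0 is allowed. *)

Section Smooth.
Context {R : realType}.

(* Only meaningful for [D] open and finite-dimensional [V], [W], where it is the
   usual notion: [f] is C^(k+1) on [D] iff it is differentiable on [D] and all
   its directional derivatives are C^k on [D]. *)
Fixpoint Ck {V W : normedModType R} (k : nat) (D : set V) (f : V -> W) : Prop :=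
  match k with
  | 0 => forall x, D x -> {for x, continuous f}
  | k'.+1 => (forall x, D x -> differentiable f x) /\
             (forall v, Ck k' D ('D_v f))
  end.

Definition smooth_on {V W : normedModType R} (D : set V) (f : V -> W) : Prop :=
  forall k, Ck k D f.

(* [cinv] is the inverse of [cmap] on [cmap @` cdom]; its values elsewhere are
   irrelevant. *)
Record chart (T : Type) (n : nat) := Chart {
  cdom : set T;
  cmap : T -> 'rV[R]_n;
  cinv : 'rV[R]_n -> T }.

Record atlas (T : Type) := Atlas {
  mdim : nat;
  mcharts : set (chart T mdim) }.

Arguments mcharts {T} a.

Definition mopen {T : Type} (A : atlas T) (W : set T) : Prop :=
  forall c, mcharts A c -> open (cmap c @` (cdom c `&` W)).

Definition is_atlas {T : Type} (A : atlas T) : Prop :=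
  [/\ forall c, mcharts A c -> forall x, cdom c x -> cinv c (cmap c x) = x,
      forall c, mcharts A c -> open (cmap c @` cdom c),
      forall x, exists2 c, mcharts A c & cdom c x &
      forall c d, mcharts A c -> mcharts A d ->
        open (cmap c @` (cdom c `&` cdom d)) /\
        smooth_on (cmap c @` (cdom c `&` cdom d)) (cmap d \o cinv c)].

Definition mhausdorff {T : Type} (A : atlas T) : Prop :=
  forall x y : T, x <> y -> exists U V : set T,
    [/\ mopen A U, mopen A V, U x, V y & U `&` V = set0].

Definition msecond_countable {T : Type} (A : atlas T) : Prop :=
  exists B : nat -> set T, (forall n, mopen A (B n)) /\
    forall W x, mopen A W -> W x -> exists n, B n x /\ B n `<=` W.

Definition smooth_manifold {T : Type} (A : atlas T) : Prop :=
  [/\ is_atlas A, mhausdorff A & msecond_countable A].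

Definition prod_chart {T U : Type} {m n : nat} (c : chart T m) (d : chart U n) :
    chart (T * U) (m + n) :=
  Chart [set p | cdom c p.1 /\ cdom d p.2]
        (fun p => row_mx (cmap c p.1) (cmap d p.2))
        (fun v => (cinv c (lsubmx v), cinv d (rsubmx v))).

Definition prod_atlas {T U : Type} (A : atlas T) (B : atlas U) : atlas (T * U) :=
  Atlas [set e | exists c d, [/\ mcharts A c, mcharts B d & e = prod_chart c d]].

(* Smoothness of [f] on [W], for [W] open.  Continuity is required separately
   since it makes the domains of the coordinate expressions open. *)
Definition smooth_map {T U : Type} (A : atlas T) (B : atlas U) (W : set T)
    (f : T -> U) : Prop :=
  (forall V, mopen B V -> mopen A (W `&` f @^-1` V)) /\
  (forall c d, mcharts A c -> mcharts B d ->
    smooth_on (cmap c @` (cdom c `&` W `&` f @^-1` cdom d))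
              (cmap d \o f \o cinv c)).

Definition smooth_fun {T : Type} (A : atlas T) (W : set T) (f : T -> R) : Prop :=
  forall c, mcharts A c ->
    smooth_on (cmap c @` (cdom c `&` W)) (f \o cinv c : 'rV[R]__ -> R^o).

Definition submersion {T U : Type} (A : atlas T) (B : atlas U) (f : T -> U) :
    Prop :=
  smooth_map A B setT f /\
  forall c d, mcharts A c -> mcharts B d ->
  forall x, cdom c x -> cdom d (f x) ->
  forall w, exists v, 'd (cmap d \o f \o cinv c) (cmap c x) v = w.

End Smooth.

Arguments chart : clear implicits.
Arguments atlas : clear implicits.

Definition lie_group {R : realType} {G : groupType} (AG : atlas R G) : Prop :=
  [/\ smooth_manifold AG,
      smooth_map (prod_atlas AG AG) AG setT (fun p => p.1 * p.2)%g &
      smooth_map AG AG setT (fun g => g^-1)%g].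

Section Action.
Context {G : groupType} {X : Type}.
Variable act : G -> X -> X.

Definition is_action : Prop :=
  (forall x, act 1%g x = x) /\
  (forall g h x, act (g * h)%g x = act g (act h x)).

Definition free_action : Prop := forall g x, act g x = x -> g = 1%g.

Definition orbit_set (x : X) : set X := [set y | exists g, y = act g x].

Definition orbit_space : Type := {c : set X | exists x, c = orbit_set x}.

Definition cls (x : X) : orbit_space :=
  exist _ (orbit_set x) (ex_intro _ x erefl).

Definition class_set (c : orbit_space) : set X := proj1_sig c.

Definition class_repr (c : orbit_space) : X := projT1 (cid (proj2_sig c)).

Lemma class_set_inj : injective class_set.
Proof.
case=> [c hc] [d hd] /= e; rewrite /class_set /= in e; subst d.
by congr exist; exact: Prop_irrelevance.
Qed.

Lemma class_reprK (c : orbit_space) : cls (class_repr c) = c.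
Proof.
apply: class_set_inj; rewrite /class_repr; case: (cid _) => x /= e.
by rewrite /class_set /= e.
Qed.

Lemma cls_eqP (x y : X) : is_action ->
  (cls x = cls y) <-> (exists g, y = act g x).
Proof.
case=> a1 aM; split => [[e]|[g ->]].
  have : orbit_set y y by exists 1%g; rewrite a1.
  by rewrite -e.
apply: class_set_inj; apply/seteqP; split => z [h ->].
  by exists (h * g^-1)%g; rewrite -aM -mulgA mulVg mulg1.
by exists (h * g)%g; rewrite aM.
Qed.

End Action.

(* The smooth structure of a quotient by a group action: a subset (resp. a real
   function on an open subset) is open (resp. smooth) iff its pullback along the
   projection is, and a map is smooth iff it is continuous and pulls local smooth
   functions back to smooth functions.  Whenever the quotient has a manifold
   structure making the projection a submersion, these are its open sets, smooth
   functions and smooth maps. *)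
Section QuotientSmooth.
Context {R : realType} {G : groupType} {X : Type}.
Variables (aX : G -> X -> X) (AX : atlas R X).

Definition quot_open (W : set (orbit_space aX)) : Prop :=
  mopen AX (cls aX @^-1` W).

Definition quot_smooth_fun (W : set (orbit_space aX)) (f : orbit_space aX -> R) :
    Prop :=
  smooth_fun AX (cls aX @^-1` W) (f \o cls aX).

End QuotientSmooth.

Definition quot_smooth_map {R : realType} {G : groupType} {X Y : Type}
    (aX : G -> X -> X) (aY : G -> Y -> Y) (AX : atlas R X) (AY : atlas R Y)
    (f : orbit_space aX -> orbit_space aY) : Prop :=
  forall W, quot_open AY W ->
    quot_open AX (f @^-1` W) /\
    forall u : orbit_space aY -> R, quot_smooth_fun AY W u ->
      quot_smooth_fun AX (f @^-1` W) (u \o f).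

Section Bundle.
Context {R : realType} {G : groupType} {Q : Type}.
Variables (act : G -> Q -> Q).
Variables (AG : atlas R G) (AQ : atlas R Q) (AS : atlas R (orbit_space act)).

Notation S := (orbit_space act).
Notation pr := (cls act).

(* [triv x g] is the point of [Q] with coordinates [(x, g)], and [tcoord q] is
   the [G]-coordinate of [q]; both matter only over [tdom]. *)
Record trivialization := Trivialization {
  tdom : set S;
  triv : S -> G -> Q;
  tcoord : Q -> G }.

Definition local_trivialization (t : trivialization) : Prop :=
  [/\ mopen AS (tdom t),
      forall x g, tdom t x -> pr (triv t x g) = x /\ tcoord t (triv t x g) = g,
      forall q, tdom t (pr q) -> triv t (pr q) (tcoord t q) = q,
      forall k x g, tdom t x -> act k (triv t x g) = triv t x (k * g)%g &
      smooth_map (prod_atlas AS AG) AQ [set p | tdom t p.1]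
                 (fun p => triv t p.1 p.2) /\
      smooth_map AQ AG (pr @^-1` tdom t) (tcoord t)].

(* [S = Q/G] is the literal orbit space, [AS] its manifold structure.  Local
   triviality is classically a consequence of the other clauses. *)
Definition principal_bundle : Prop :=
  [/\ lie_group AG, smooth_manifold AQ /\ smooth_manifold AS,
      [/\ is_action act, free_action act &
          smooth_map (prod_atlas AG AQ) AQ setT (fun p => act p.1 p.2)],
      submersion AQ AS pr &
      forall x : S, exists2 t, local_trivialization t & tdom t x].

Definition diag_act (k : G) (p : Q * Q) : Q * Q := (act k p.1, act k p.2).

Definition adj_act (k : G) (p : Q * G) : Q * G :=
  (act k p.1, (k * p.2 * k^-1)%g).

Notation QQ_G := (orbit_space diag_act).
Notation Gtilde := (orbit_space adj_act).

(* The maps out of the quotients are computed on a representative; the lemmas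
   below give their values on every class. *)
Definition base_QQ (c : QQ_G) : S := pr (class_repr c).1.

Definition base_Gtilde (c : Gtilde) : S := pr (class_repr c).1.

Definition atiyah_i (c : Gtilde) : QQ_G :=
  let p := class_repr c in cls diag_act (p.1, act p.2 p.1).

Lemma diag_act_is_action : is_action act -> is_action diag_act.
Proof.
case=> a1 aM; split => [[x y]|g h [x y]]; rewrite /diag_act /= ?a1 //.
by rewrite !aM.
Qed.

Lemma adj_act_is_action : is_action act -> is_action adj_act.
Proof.
case=> a1 aM; split => [[x y]|g h [x y]]; rewrite /adj_act /=.
  by rewrite a1 invg1 mulg1 mul1g.
by rewrite aM invgM !mulgA.
Qed.

Lemma base_QQ_cls q0 q1 : is_action act -> base_QQ (cls diag_act (q0, q1)) = pr q0.
Proof.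
move=> a; apply/esym/(cls_eqP _ _ a).
have /esym/(cls_eqP _ _ (diag_act_is_action a)) [g ->] :=
  class_reprK (cls diag_act (q0, q1)).
by exists g.
Qed.

Lemma base_Gtilde_cls q g : is_action act -> base_Gtilde (cls adj_act (q, g)) = pr q.
Proof.
move=> a; apply/esym/(cls_eqP _ _ a).
have /esym/(cls_eqP _ _ (adj_act_is_action a)) [k ->] :=
  class_reprK (cls adj_act (q, g)).
by exists k.
Qed.

Lemma atiyah_i_cls q g : is_action act ->
  atiyah_i (cls adj_act (q, g)) = cls diag_act (q, act g q).
Proof.
move=> a; apply/esym/(cls_eqP _ _ (diag_act_is_action a)).
have /esym/(cls_eqP _ _ (adj_act_is_action a)) [k ->] :=
  class_reprK (cls adj_act (q, g)).
exists k; rewrite /diag_act /adj_act /=; congr pair.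
by case: a => _ aM; rewrite -!aM -mulgA mulVg mulg1.
Qed.

Definition atiyah_splitting (phi : QQ_G -> Gtilde) : Prop :=
  [/\ quot_smooth_map (prod_atlas AQ AQ) (prod_atlas AQ AG) phi,
      forall c, base_Gtilde (phi c) = base_QQ c &
      phi \o atiyah_i = id].

(* [t0] and [t1] are trivializations near the two base points; one
   trivialization containing both is the case [t0 = t1]. *)
Definition in_class_of_splitting (phi : QQ_G -> Gtilde)
    (t0 t1 : trivialization) (x0 x1 : S) (g0 g1 g : G) : Prop :=
  class_set (phi (cls diag_act (triv t0 x0 g0, triv t1 x1 g1)))
            (triv t0 x0 1%g, g).

Definition form_of_splitting (phi : QQ_G -> Gtilde) (Ad : Q * Q -> G) : Prop :=
  forall t0 t1 x0 x1 g0 g1 g,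
    local_trivialization t0 -> local_trivialization t1 ->
    tdom t0 x0 -> tdom t1 x1 ->
    in_class_of_splitting phi t0 t1 x0 x1 g0 g1 g ->
    Ad (triv t0 x0 1%g, triv t1 x1 (g0^-1 * g1)%g) = g /\
    Ad (triv t0 x0 g0, triv t1 x1 g1) = (g0 * g * g0^-1)%g.

Definition discrete_connection_form (Ad : Q * Q -> G) : Prop :=
  [/\ smooth_map (prod_atlas AQ AQ) AG setT Ad,
      forall g q0 q1, Ad (act g q0, act g q1) = (g * Ad (q0, q1) * g^-1)%g &
      forall g q0, Ad (q0, act g q0) = g].

End Bundle.

(* Main.v *)
(* Every class of [Gtilde] over [pr q] contains exactly one pair [(q, g)], by
   freeness of the action; [Ad (q0, q1)] is the [g] of the class
   [phi [q0, q1]] over [pr q0], which makes the algebraic properties immediate.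
   For smoothness, let [s] be the [G]-coordinate of a local trivialization: the
   map [(q, g) |-> s(q)^-1 g s(q)] is smooth and invariant, so its coordinates
   in a chart of [G] are smooth functions on an open part of [Gtilde], which
   [phi] pulls back to smooth functions.  The resulting map [b] is smooth and
   [Ad (q0, q1) = s(q0) b(q0, q1) s(q0)^-1]. *)
Require Import Defs.
From HB Require Import structures.
From mathcomp Require Import all_boot all_order all_algebra.
From mathcomp Require Import all_classical all_reals all_analysis.
Import numFieldNormedType.Exports.
Import Order.TTheory GRing.Theory Num.Theory.
Set Implicit Arguments.
Unset Strict Implicit.
Unset Printing Implicit Defensive.
Local Open Scope classical_set_scope.
Local Open Scope ring_scope.

(** * Maps of class C^k *)

Section Calculus.
Context {R : realType}.
Implicit Types V W : normedModType R.

(** The first-order expansion of [f] at [x] constrains only points near [x], so ['d f x] also serves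
    in the expansion of [g]; [diff_unique] then identifies it with ['d g x]. *)
Lemma near_eq_differentiable V W (f g : V -> W) x :
  (\near x, f x = g x) -> differentiable f x -> differentiable g x.
Proof.
move=> fg /[dup] df /diff_locallyP[dfc /eqaddoP fo].
have dg : g \o shift x = cst (g x) + 'd f x +o_ 0 id.
  apply/eqaddoP => e e0; have := fo e e0; apply: filter_app.
  have fg0 : \forall h \near (0 : V), f (h + x) = g (h + x).
    rewrite (near_shift x) sub0r; apply: filterS fg => y /=.
    by rewrite addrNK.
  apply: filterS fg0 => h fgh.
  have e1 : f x = g x by exact: nbhs_singleton fg.
  by rewrite !fctE /= fgh e1.
have e := diff_unique dfc dg.
by apply/diff_locallyP; rewrite e.
Qed.

Lemma Ck_subset V W k (D E : set V) (f : V -> W) :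
  D `<=` E -> Ck k E f -> Ck k D f.
Proof.
elim: k f => [|k IH] f DE /=; first by move=> + x /DE; apply.
by move=> [df Df]; split=> [x /DE|v]; [exact: df|exact: IH].
Qed.

(** [D] never restricts the function being differentiated: it only selects the points where
    conditions are imposed. Regularity can therefore be checked one point at a time, which is how
    local charts get glued in [smooth_mapP]. *)
Lemma Ck_pointwise V W k (D : set V) (f : V -> W) :
  (forall x, D x -> Ck k [set x] f) -> Ck k D f.
Proof.
elim: k f => [|k IH] f Df /=; first by move=> x /Df; apply.
split=> [x Dx|v]; first by have [+ _] := Df x Dx; apply.
by apply: IH => x /Df[_]; apply.
Qed.

(** On an open [D] the two functions agree near each point, so they have the same directional
    derivatives there and the induction goes on with these. *)
Lemma Ck_ext V W k (D : set V) (f g : V -> W) :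
  open D -> {in D, f =1 g} -> Ck k D f -> Ck k D g.
Proof.
move=> oD; elim: k f g => [|k IH] f g fg.
  move=> Df x Dx; change (g y @[y --> x] --> g x).
  rewrite -(fg x) ?inE//.
  apply: cvg_trans (Df x Dx); apply: near_eq_cvg.
  by apply: filterS (open_nbhs_nbhs (conj oD Dx)) => y Dy; rewrite fg// inE.
have near_fg x : D x -> \forall y \near x, f y = g y.
  move=> Dx; apply: filterS (open_nbhs_nbhs (conj oD Dx)) => y Dy.
  by rewrite fg ?inE.
case=> df Df; split=> [x Dx|v].
  exact: near_eq_differentiable (near_fg _ Dx) (df x Dx).
apply: IH (Df v) => x; rewrite inE => Dx.
exact: near_eq_derive (near_fg _ Dx).
Qed.

Lemma Ck_ltW V W k (D : set V) (f : V -> W) : Ck k.+1 D f -> Ck k D f.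
Proof.
elim: k f => [|k IH] f [df Df]; last by split=> // v; apply: IH.
by move=> x Dx; apply/differentiable_continuous/df.
Qed.

Lemma Ck_cst V W k (D : set V) (a : W) : Ck k D (cst a : V -> W).
Proof.
elim: k a => [|k IH] a; first by move=> x _; exact: cst_continuous.
split=> [x _|v]; first exact: differentiable_cst.
rewrite (_ : 'D_v _ = cst 0) //.
by apply/funext => x; rewrite derive_cst.
Qed.

Lemma Ck_linear V W k (D : set V) (f : {linear V -> W}) :
  continuous f -> Ck k D f.
Proof.
move=> cf; case: k => [|k]; first by move=> x _; exact: cf.
split=> [x _|v]; first exact: linear_differentiable.
rewrite (_ : 'D_v _ = cst (f v)); first exact: Ck_cst.
apply/funext => x; rewrite deriveE; last exact: linear_differentiable.
by rewrite diff_lin.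
Qed.

Lemma Ck_add V W k (D : set V) (f g : V -> W) : open D ->
  Ck k D f -> Ck k D g -> Ck k D (f + g).
Proof.
move=> oD; elim: k f g => [|k IH] f g.
  by move=> cf cg x Dx; apply: cvgD; [exact: cf|exact: cg].
move=> [df Df] [dg Dg]; split=> [x Dx|v].
  by apply: differentiableD; [exact: df|exact: dg].
apply: Ck_ext (IH _ _ (Df v) (Dg v)) => // x; rewrite inE => Dx.
by rewrite deriveD//; apply: diff_derivable; [exact: df|exact: dg].
Qed.

Lemma Ck_sum V W k (D : set V) n (f : 'I_n -> V -> W) : open D ->
  (forall i, Ck k D (f i)) -> Ck k D (\sum_(i < n) f i).
Proof.
move=> oD Df; elim/big_ind : _ => //; first exact: Ck_cst.
by move=> g h; exact: Ck_add.
Qed.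

Lemma Ck_mul V k (D : set V) (f g : V -> R^o) : open D ->
  Ck k D f -> Ck k D g -> Ck k D (f * g : V -> R^o).
Proof.
move=> oD; elim: k f g => [|k IH] f g.
  by move=> cf cg x Dx; apply: cvgM; [exact: cf|exact: cg].
move=> fk gk; have [[df Df] [dg Dg]] := (fk, gk); split=> [x Dx|v].
  by apply: differentiableM; [exact: df|exact: dg].
have h := Ck_add oD (IH _ _ (Ck_ltW fk) (Dg v)) (IH _ _ (Ck_ltW gk) (Df v)).
apply: Ck_ext h => // x; rewrite inE => Dx.
by rewrite deriveM//; apply: diff_derivable; [exact: df|exact: dg].
Qed.

Lemma differentiable_coordP V n (f : V -> 'rV[R]_n) x :
  differentiable f x <-> forall j, differentiable (fun y => f y 0 j : R^o) x.
Proof.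
split=> [df j|df].
  exact: (differentiable_comp df (differentiable_coord _ 0 j)).
rewrite (_ : f = \sum_(j < n) (fun y => f y 0 j *: delta_mx 0 j)).
  by apply: differentiable_sum => j; apply: differentiableZl.
by apply/funext => y; rewrite [LHS]row_sum_delta fct_sumE.
Qed.

Lemma Ck_coordP V n k (D : set V) (f : V -> 'rV[R]_n) : open D ->
  Ck k D f <-> forall j, Ck k D (fun y => f y 0 j : R^o).
Proof.
move=> oD; elim: k f => [|k IH] f.
  split=> [cf j x Dx|cf x Dx].
    apply: (@continuous_comp _ _ _ f (fun u : 'rV_n => u 0 j : R^o)).
      exact: cf.
    exact: coord_continuous.
  (* A neighbourhood of a matrix contains a box given by neighbourhoods [P i j] of its entries; as
     these are finitely many, the entrywise conditions hold simultaneously near [x]. *)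
  move=> A [P fP PA]; rewrite !near_simpl.
  have : \forall y \near x, forall i j, P i j (f y i j).
    apply: filter_forall => i; apply: filter_forall => j.
    by rewrite (ord1 i); apply: (cf j x Dx); rewrite -(ord1 i).
  by apply: filterS => y Py; exact: PA.
have dE v j : (forall x, D x -> differentiable f x) ->
    {in D, (fun y => 'D_v f y 0 j) =1 'D_v (fun y => f y 0 j : R^o)}.
  move=> df x; rewrite inE => Dx.
  by rewrite derive_mx ?mxE//; apply/diff_derivable/df.
split=> [[df Df] j|fj].
  split=> [x Dx|v]; first by have /differentiable_coordP := df x Dx; apply.
  by have /IH/(_ j) := Df v; apply: Ck_ext => //; exact: dE.
have df x : D x -> differentiable f x.
  by move=> Dx; apply/differentiable_coordP => j; have [+ _] := fj j; apply.
split=> // v; apply/IH => j; have [_ /(_ v)] := fj j.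
by apply: Ck_ext => // x Dx; rewrite dE.
Qed.

(** The outer function is scalar so that the chain rule becomes a sum of products of scalar
    functions, within reach of [Ck_mul] and [Ck_sum]; [Ck_comp] follows coordinate by coordinate. *)
Lemma Ck_comp_real V n k (D : set V) (E : set 'rV[R]_n)
    (f : V -> 'rV[R]_n) (g : 'rV[R]_n -> R^o) : open D ->
  (forall x, D x -> E (f x)) -> Ck k D f -> Ck k E g -> Ck k D (g \o f).
Proof.
move=> oD DE; elim: k f g DE => [|k IH] f g DE.
  by move=> cf cg x Dx; apply: continuous_comp; [exact: cf|exact/cg/DE].
move=> fk gk; have [[df Df] [dg Dg]] := (fk, gk); split=> [x Dx|v].
  by apply: differentiable_comp; [exact: df|exact/dg/DE].
(* Chain rule: the derivative of [g \o f] along [v] is the sum over [j] of the [j]-th coordinate of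
   ['D_v f] times the [j]-th partial derivative of [g] taken at [f]. The induction hypothesis
   applies to the partial derivatives, with [f] lowered to class [k]. *)
have h : Ck k D (\sum_(j < n) ((fun x => 'D_v f x 0 j : R^o) *
                                 ('D_(delta_mx 0 j) g \o f) : V -> R^o)).
  apply: Ck_sum => // j; apply: Ck_mul => //; last exact: IH (Ck_ltW fk) (Dg _).
  by have /Ck_coordP := Df v; apply.
apply: Ck_ext h => // x; rewrite inE => Dx.
have dfx := df x Dx; have dgx := dg _ (DE x Dx).
rewrite deriveE; last exact: differentiable_comp.
rewrite diff_comp //= -(deriveE _ dfx) [in RHS](row_sum_delta ('D_v f x)).
rewrite linear_sum fct_sumE; apply: eq_bigr => j _.
by rewrite linearZ -deriveE.
Qed.

Lemma Ck_comp V n m k (D : set V) (E : set 'rV[R]_n)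
    (f : V -> 'rV[R]_n) (g : 'rV[R]_n -> 'rV[R]_m) : open D -> open E ->
  (forall x, D x -> E (f x)) -> Ck k D f -> Ck k E g -> Ck k D (g \o f).
Proof.
move=> oD oE DE fk /Ck_coordP-/(_ oE) gk; apply/Ck_coordP => // j.
exact: Ck_comp_real DE fk (gk j).
Qed.

Lemma Ck_row_mx V n m k (D : set V) (f : V -> 'rV[R]_n) (g : V -> 'rV[R]_m) :
  open D -> Ck k D f -> Ck k D g -> Ck k D (fun x => row_mx (f x) (g x)).
Proof.
move=> oD /Ck_coordP-/(_ oD) fk /Ck_coordP-/(_ oD) gk; apply/Ck_coordP => // j.
case: (split_ordP j) => i ->.
  by rewrite (_ : (fun _ => _) = fun x => f x 0 i)//;
    apply/funext => x; rewrite row_mxEl.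
by rewrite (_ : (fun _ => _) = fun x => g x 0 i)//;
  apply/funext => x; rewrite row_mxEr.
Qed.

Lemma Ck_lsubmx n m k (D : set 'rV[R]_(n + m)) :
  Ck k D (lsubmx : 'rV[R]_(n + m) -> 'rV[R]_n).
Proof. exact/Ck_linear/continuous_lsubmx. Qed.

Lemma Ck_rsubmx n m k (D : set 'rV[R]_(n + m)) :
  Ck k D (rsubmx : 'rV[R]_(n + m) -> 'rV[R]_m).
Proof. exact/Ck_linear/continuous_rsubmx. Qed.

Lemma Ck_preimage_open V W (D : set V) (f : V -> W) (P : set W) :
  open D -> Ck 0 D f -> open P -> open (D `&` f @^-1` P).
Proof.
move=> oD cf oP; rewrite openE => x [Dx Px].
apply: filterI; first exact: open_nbhs_nbhs.
by apply: cf => //; exact: open_nbhs_nbhs.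
Qed.

End Calculus.

(** * Smooth maps between manifolds *)

Local Arguments mcharts {R T} a.

Section AtlasTopology.
Context {R : realType}.

Lemma mopen_bigcup T (A : atlas R T) (W : set T) :
  (forall x, W x -> exists N, [/\ mopen A N, N x & N `<=` W]) -> mopen A W.
Proof.
move=> loc c Ac; rewrite openE => _ [x [cx Wx] <-].
have [N [ oN Nx NW]] := loc x Wx.
have : nbhs (cmap c x) (cmap c @` (cdom c `&` N)).
  by apply: open_nbhs_nbhs; split; [exact: oN|exists x].
by apply: filterS => _ [y [cy Ny] <-]; exists y => //; split=> //; exact: NW.
Qed.

Context {T : Type} {A : atlas R T} (atA : is_atlas A).

Lemma chartK (c : chart R T (mdim A)) x :
  mcharts A c -> cdom c x -> cinv c (cmap c x) = x.
Proof. by move=> Ac; case: atA => + _ _ _; apply. Qed.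

Lemma chart_exists x : exists2 c, mcharts A c & cdom c x.
Proof. by case: atA. Qed.

(** A chart is injective on its domain, so taking images commutes with intersection. *)
Lemma chart_imageI (c : chart R T (mdim A)) (U V : set T) : mcharts A c ->
  cmap c @` (cdom c `&` (U `&` V)) =
  (cmap c @` (cdom c `&` U)) `&` (cmap c @` (cdom c `&` V)).
Proof.
move=> Ac; apply/seteqP; split=> [_ [x [cx [Ux Vx]] <-]|].
  by split; exists x.
move=> _ [[x [cx Ux] <-] [y [cy Vy] e]].
have yx : y = x by rewrite -(chartK Ac cy) e chartK.
by exists x => //; split=> //; split=> //; rewrite -yx.
Qed.

Lemma mopenT : mopen A setT.
Proof. by move=> c Ac; rewrite setIT; case: atA => _ + _ _; apply. Qed.

Lemma mopenI (U V : set T) : mopen A U -> mopen A V -> mopen A (U `&` V).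
Proof.
move=> oU oV c Ac; rewrite chart_imageI//.
by apply: openI; [exact: oU|exact: oV].
Qed.

Lemma mopen_cdom c : mcharts A c -> mopen A (cdom c).
Proof. by move=> Ac d Ad; case: atA => _ _ _ /(_ d c Ad Ac) [].  Qed.

Lemma mopen_chart_image c (U : set T) : mcharts A c -> mopen A U ->
  U `<=` cdom c -> open (cmap c @` U).
Proof. by move=> Ac oU Uc; rewrite -(setIidr Uc); apply: oU. Qed.

Lemma mopen_chart_preimage c (P : set 'rV[R]_(mdim A)) : mcharts A c ->
  open P -> mopen A (cdom c `&` cmap c @^-1` P).
Proof.
move=> Ac oP d Ad; case: atA => _ _ _ /(_ d c Ad Ac)[ opn sm].
(* Seen in the chart [d], the set is the preimage of [P] under the transition map from [d] to [c],
   which is continuous on the overlap. *)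
rewrite (_ : _ @` _ = (cmap d @` (cdom d `&` cdom c)) `&`
                      (cmap c \o cinv d) @^-1` P).
  exact: Ck_preimage_open (sm 0%N) oP.
apply/seteqP; split=> [_ [x [dx [cx Px]] <-]|].
  by split; [exists x|rewrite /= chartK].
by move=> _ [[x [dx cx] <-] /=]; rewrite chartK// => Px; exists x.
Qed.

End AtlasTopology.

(** * Smoothness at a point *)

Section SmoothAt.
Context {R : realType}.

(* The open set [N] is required to be mapped into the domain of [d], so that
   this entails the continuity of [f] at [x]. *)
Definition smooth_in_charts {T U : Type} (A : atlas R T) (B : atlas R U)
    (f : T -> U) (x : T) c d : Prop :=
  exists N : set T, [/\ mopen A N, N x,
    N `<=` cdom c, N `<=` f @^-1` cdom d &
    smooth_on (cmap c @` N) (cmap d \o f \o cinv c :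
      'rV[R]_(mdim A) -> 'rV[R]_(mdim B))].

Arguments smooth_in_charts {T U} A B f x c d.

Definition smooth_at {T U : Type} (A : atlas R T) (B : atlas R U)
    (f : T -> U) (x : T) : Prop :=
  exists c d, [/\ mcharts A c, mcharts B d & smooth_in_charts A B f x c d].

Lemma smooth_at_nbhs {T U} {A : atlas R T} {B : atlas R U} (f : T -> U) x V :
  is_atlas A -> is_atlas B -> smooth_at A B f x -> mopen B V -> V (f x) ->
  exists N, [/\ mopen A N, N x & N `<=` f @^-1` V].
Proof.
move=> atA atB [c [d [Ac Bd [N [ oN Nx Nc Nd sm]]]]] oV Vfx.
have oN' := mopen_chart_image Ac oN Nc.
have oP := Ck_preimage_open oN' (sm 0%N) (oV d Bd).
(* The neighbourhood is cut out in the coordinates of [c], as the part of the image of [N] that the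
   coordinate expression of [f] sends into the image of [V]. *)
exists (cdom c `&` cmap c @^-1` (cmap c @` N `&`
          (cmap d \o f \o cinv c) @^-1` (cmap d @` (cdom d `&` V)))); split.
- exact: mopen_chart_preimage.
- split; first exact: Nc.
  split; first by exists x.
  rewrite /= (chartK atA Ac (Nc _ Nx)); exists (f x) => //; split=> //.
  exact: Nd.
- move=> y [cy [[z Nz zy] /=]]; rewrite (chartK atA)// => -[w [dw Vw] e].
  have zE : z = y by rewrite -(chartK atA Ac (Nc _ Nz)) zy (chartK atA).
  have dy : cdom d (f y) by rewrite -zE; exact: Nd.
  by rewrite -(chartK atB Bd dy) -e (chartK atB).
Qed.

(** Independence of the charts: on a small enough set the expression of [f] in [c], [d] is the one
    in [c'], [d'] composed with the transition maps from [c] to [c'] and from [d'] to [d]. *)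
Lemma smooth_at_in_charts {T U} {A : atlas R T} {B : atlas R U} (f : T -> U) x
    c d : is_atlas A -> is_atlas B -> smooth_at A B f x ->
  mcharts A c -> mcharts B d -> cdom c x -> cdom d (f x) ->
  smooth_in_charts A B f x c d.
Proof.
move=> atA atB smx Ac Bd cx dfx.
have [N' [ oN' N'x N'd]] := smooth_at_nbhs atA atB smx (mopen_cdom atB Bd) dfx.
have [c' [d' [Ac' Bd' [N [ oN Nx Nc' Nd' sm]]]]] := smx.
(* [M] lies in both source charts, and [f] maps it into both target charts, so all three composed
   maps are defined on it. *)
pose M := N `&` N' `&` cdom c.
have oM : mopen A M.
  by apply: (mopenI atA); [exact: (mopenI atA)|exact: (mopen_cdom atA)].
have Mc : M `<=` cdom c by move=> y [].
have Mc' : M `<=` cdom c' by move=> y [[/Nc']].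
exists M; split=> //; first by move=> y [[_ /N'd]].
move=> k.
have oMc := mopen_chart_image Ac oM Mc.
have oMc' := mopen_chart_image Ac' oM Mc'.
have [_ smA] : open (cmap c @` (cdom c `&` cdom c')) /\
  smooth_on (cmap c @` (cdom c `&` cdom c')) (cmap c' \o cinv c).
  by case: atA => _ _ _; apply.
have [ oB smB] : open (cmap d' @` (cdom d' `&` cdom d)) /\
  smooth_on (cmap d' @` (cdom d' `&` cdom d)) (cmap d \o cinv d').
  by case: atB => _ _ _; apply.
have h1 : Ck k (cmap c @` M) (cmap c' \o cinv c).
  apply: Ck_subset (smA k) => _ [y My <-]; exists y => //.
  by split; [exact: Mc|exact: Mc'].
have h2 : Ck k (cmap c' @` M) (cmap d' \o f \o cinv c').
  by apply: Ck_subset (sm k) => _ [y [[Ny _] _] <-]; exists y.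
have m1 v : (cmap c @` M) v -> (cmap c' @` M) ((cmap c' \o cinv c) v).
  by move=> [y My <-] /=; rewrite (chartK atA Ac (Mc _ My)); exists y.
have h12 := Ck_comp oMc oMc' m1 h1 h2.
have m2 v : (cmap c @` M) v -> (cmap d' @` (cdom d' `&` cdom d))
    (((cmap d' \o f \o cinv c') \o (cmap c' \o cinv c)) v).
  move=> [y My <-] /=.
  rewrite (chartK atA Ac (Mc _ My)) (chartK atA Ac' (Mc' _ My)).
  by exists (f y) => //; case: My => -[/Nd' ? /N'd ?] _; split.
apply: Ck_ext (Ck_comp oMc oB m2 h12 (smB k)) => //.
move=> _ /set_mem[y My <-] /=.
rewrite (chartK atA Ac (Mc _ My)) (chartK atA Ac' (Mc' _ My)) (chartK atB)//.
by case: My => -[/Nd'].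
Qed.

(** This moves all later arguments to [smooth_at], where domains can be shrunk freely for
    compositions and products. *)
Lemma smooth_mapP {T U} {A : atlas R T} {B : atlas R U} (W : set T)
    (f : T -> U) : is_atlas A -> is_atlas B ->
  smooth_map A B W f <-> mopen A W /\ forall x, W x -> smooth_at A B f x.
Proof.
move=> atA atB; split=> [[cf sm]|[ oW sm]].
  split=> [|x Wx].
    by rewrite -(setIT W); exact: cf (mopenT atB).
  have [[c Ac cx] [d Bd dfx]] := (chart_exists atA x, chart_exists atB (f x)).
  exists c, d; split=> //; exists (cdom c `&` W `&` f @^-1` cdom d); split=> //.
  - rewrite -setIA; apply: (mopenI atA); first exact: (mopen_cdom atA).
    exact/cf/(mopen_cdom atB).
  - by move=> y [[]].
  - by move=> k; exact: (sm c d).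
split=> [V oV|c d Ac Bd k].
  apply: mopen_bigcup => x [Wx Vfx].
  have [N [ oN Nx NV]] := smooth_at_nbhs atA atB (sm x Wx) oV Vfx.
  exists (W `&` N); split=> //; first exact: (mopenI atA).
  by move=> y [Wy /NV].
(* It remains to treat a single point in the prescribed charts [c] and [d], which chart independence
   provides. *)
apply: Ck_pointwise => _ [x [[cx Wx] dfx] <-].
have [N [_ Nx _ _ smN]] := smooth_at_in_charts atA atB (sm x Wx) Ac Bd cx dfx.
by apply: Ck_subset (smN k) => _ ->; exists x.
Qed.

Lemma smooth_at_comp {T U X} {A : atlas R T} {B : atlas R U} {C : atlas R X}
    (f : T -> U) (g : U -> X) x : is_atlas A -> is_atlas B -> is_atlas C ->
  smooth_at A B f x -> smooth_at B C g (f x) -> smooth_at A C (g \o f) x.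
Proof.
move=> atA atB atC smf smg; have [c [d [Ac Bd [N [ oN Nx Nc Nd sm]]]]] := smf.
have [e Ce egx] := chart_exists atC (g (f x)).
(* The expression of [g] is taken in the same middle chart [d] as that of [f], so the two compose
   without a transition map. *)
have [M [ oM Mx Md Me sm']] :=
  smooth_at_in_charts atB atC smg Bd Ce (Nd _ Nx) egx.
have [N' [ oN' N'x N'M]] := smooth_at_nbhs atA atB smf oM Mx.
have oI := mopenI atA oN oN'.
exists c, e; split=> //; exists (N `&` N'); split=> //.
- by move=> y [/Nc].
- by move=> y [_ /N'M /Me].
move=> k.
have oIc : open (cmap c @` (N `&` N')).
  by apply: mopen_chart_image => // y [/Nc].
have oMd := mopen_chart_image Bd oM Md.
have h1 : Ck k (cmap c @` (N `&` N')) (cmap d \o f \o cinv c).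
  by apply: Ck_subset (sm k) => _ [y [Ny _] <-]; exists y.
have m1 v : (cmap c @` (N `&` N')) v ->
    (cmap d @` M) ((cmap d \o f \o cinv c) v).
  move=> [y [Ny N'y] <-] /=; rewrite (chartK atA Ac (Nc _ Ny)).
  by exists (f y) => //; exact: N'M.
apply: Ck_ext (Ck_comp oIc oMd m1 h1 (sm' k)) => //.
move=> _ /set_mem[y [Ny N'y] <-] /=.
by rewrite (chartK atA Ac (Nc _ Ny)) (chartK atB)//; exact: Nd.
Qed.

Lemma smooth_at_ext {T U} {A : atlas R T} {B : atlas R U} (W : set T)
    (f g : T -> U) x : is_atlas A -> mopen A W -> W x ->
  (forall y, W y -> f y = g y) -> smooth_at A B f x -> smooth_at A B g x.
Proof.
move=> atA oW Wx fg [c [d [Ac Bd [N [ oN Nx Nc Nd sm]]]]].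
have oI := mopenI atA oN oW.
exists c, d; split=> //; exists (N `&` W); split=> //.
- by move=> y [/Nc].
- by move=> y [/Nd + /fg /= <-].
move=> k; apply: (@Ck_ext _ _ _ _ _ (cmap d \o f \o cinv c)).
- by apply: mopen_chart_image => // y [/Nc].
- by move=> _ /set_mem[y [Ny Wy] <-] /=; rewrite (chartK atA) ?fg//; exact: Nc.
- by apply: Ck_subset (sm k) => _ [y [Ny _] <-]; exists y.
Qed.

Lemma smooth_at_pair {T U X} {A : atlas R T} {B : atlas R U} {C : atlas R X}
    (f : T -> U) (g : T -> X) x : is_atlas A -> is_atlas B -> is_atlas C ->
  smooth_at A B f x -> smooth_at A C g x ->
  smooth_at A (prod_atlas B C) (fun y => (f y, g y)) x.
Proof.
move=> atA atB atC smf smg; have [c Ac cx] := chart_exists atA x.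
have [d Bd dfx] := chart_exists atB (f x).
have [e Ce egx] := chart_exists atC (g x).
have [N [ oN Nx Nc Nd sm]] := smooth_at_in_charts atA atB smf Ac Bd cx dfx.
have [M [ oM Mx Mc Me sm']] := smooth_at_in_charts atA atC smg Ac Ce cx egx.
have oI := mopenI atA oN oM.
exists c, (prod_chart d e); split=> //; first by exists d, e.
exists (N `&` M); split=> //.
- by move=> y [/Nc].
- by move=> y [/Nd ? /Me ?].
move=> k; apply: Ck_row_mx.
- by apply: mopen_chart_image => // y [/Nc].
- by apply: Ck_subset (sm k) => _ [y [Ny _] <-]; exists y.
- by apply: Ck_subset (sm' k) => _ [y [_ My] <-]; exists y.
Qed.

(** * Product manifolds and their projections *)

Section Product.
Context {T U : Type} {A : atlas R T} {B : atlas R U}.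
Hypotheses (atA : is_atlas A) (atB : is_atlas B).

Lemma prod_chart_image c d (N : set T) (M : set U) :
  cmap (prod_chart c d) @` [set p | N p.1 /\ M p.2] =
  lsubmx @^-1` (cmap c @` N) `&`
  rsubmx @^-1` (cmap d @` M) :> set 'rV[R]_(mdim A + mdim B).
Proof.
apply/seteqP; split=> [_ [[x y] [/= Nx My] <-]|v [[x Nx xv] [y My yv]]].
  by split=> /=; [rewrite row_mxKl; exists x|rewrite row_mxKr; exists y].
by exists (x, y) => //=; rewrite xv yv hsubmxK.
Qed.

Lemma open_prod_chart_image n m (P : set 'rV[R]_n) (P' : set 'rV[R]_m) :
  open P -> open P' ->
  open (lsubmx @^-1` P `&` rsubmx @^-1` P' : set 'rV[R]_(n + m)).
Proof.
by move=> oP oP'; apply: openI; apply: open_comp => // v _;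
  [exact: continuous_lsubmx|exact: continuous_rsubmx].
Qed.

Lemma is_atlas_prod : is_atlas (prod_atlas A B).
Proof.
split.
- move=> _ [c [d [Ac Bd ->]]] [x y] [/= cx dy].
  by rewrite row_mxKl row_mxKr (chartK atA)// (chartK atB).
- move=> _ [c [d [Ac Bd ->]]]; rewrite prod_chart_image.
  by apply: open_prod_chart_image;
    [case: atA => _ + _ _; exact|case: atB => _ + _ _; exact].
- move=> [x y]; have [c Ac cx] := chart_exists atA x.
  have [d Bd dy] := chart_exists atB y.
  by exists (prod_chart c d) => //; exists c, d.
- move=> _ _ [c [d [Ac Bd ->]]] [c' [d' [Ac' Bd' ->]]].
  have [ oc sc] : open (cmap c @` (cdom c `&` cdom c')) /\
    smooth_on (cmap c @` (cdom c `&` cdom c')) (cmap c' \o cinv c).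
    by case: atA => _ _ _; apply.
  have [ od sd] : open (cmap d @` (cdom d `&` cdom d')) /\
    smooth_on (cmap d @` (cdom d `&` cdom d')) (cmap d' \o cinv d).
    by case: atB => _ _ _; apply.
  rewrite (_ : cdom (prod_chart c d) `&` cdom (prod_chart c' d') =
    [set p | (cdom c `&` cdom c') p.1 /\ (cdom d `&` cdom d') p.2]); last first.
    by apply/seteqP; split=> p [[] ? ? []].
  rewrite prod_chart_image; set D := _ `&` _.
  have oD : open D by exact: open_prod_chart_image.
  (* The transition map of product charts acts blockwise: each block is a transition map of one
     factor after a linear projection. *)
  split=> // k; apply: Ck_row_mx => //.
    by apply: (Ck_comp oD oc _ _ (sc k)) => [v []|]; last exact: Ck_lsubmx.
  by apply: (Ck_comp oD od _ _ (sd k)) => [v []|]; last exact: Ck_rsubmx.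
Qed.

Lemma smooth_at_fst p : smooth_at (prod_atlas A B) A fst p.
Proof.
have [[c Ac cx] [d Bd dy]] := (chart_exists atA p.1, chart_exists atB p.2).
have Pcd : mcharts (prod_atlas A B) (prod_chart c d) by exists c, d.
exists (prod_chart c d), c; split=> //.
exists (cdom (prod_chart c d)); split=> //.
- exact: (mopen_cdom is_atlas_prod).
- by move=> q [].
have oD : open (cmap (prod_chart c d) @` cdom (prod_chart c d)).
  by case: is_atlas_prod => _ + _ _; apply.
move=> k; apply: (@Ck_ext _ 'rV[R]_(mdim A + mdim B) _ _ _ lsubmx) => //.
  by move=> _ /set_mem[q [cq dq] <-] /=; rewrite !row_mxKl (chartK atA).
exact: Ck_lsubmx.
Qed.

Lemma smooth_at_snd p : smooth_at (prod_atlas A B) B snd p.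
Proof.
have [[c Ac cx] [d Bd dy]] := (chart_exists atA p.1, chart_exists atB p.2).
have Pcd : mcharts (prod_atlas A B) (prod_chart c d) by exists c, d.
exists (prod_chart c d), d; split=> //.
exists (cdom (prod_chart c d)); split=> //.
- exact: (mopen_cdom is_atlas_prod).
- by move=> q [].
have oD : open (cmap (prod_chart c d) @` cdom (prod_chart c d)).
  by case: is_atlas_prod => _ + _ _; apply.
move=> k; apply: (@Ck_ext _ 'rV[R]_(mdim A + mdim B) _ _ _ rsubmx) => //.
  by move=> _ /set_mem[q [cq dq] <-] /=; rewrite !row_mxKr (chartK atB).
exact: Ck_rsubmx.
Qed.

End Product.

End SmoothAt.

(** * The discrete connection form of a splitting *)

Lemma class_setP {G : groupType} {X : Type} {aX : G -> X -> X} : is_action aX ->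
  forall (c : orbit_space aX) x, class_set c x <-> c = cls aX x.
Proof.
move=> haX c x; rewrite -(class_reprK c).
exact: (iff_sym (cls_eqP _ _ haX)).
Qed.

(** * Products and inverses of smooth maps into a Lie group *)

Section LieGroup.
Context {R : realType} {G : groupType} {AG : atlas R G} (hG : lie_group AG).
Context {T : Type} {A : atlas R T} (atA : is_atlas A).

Lemma lie_group_atlas : is_atlas AG.
Proof. by case: hG => -[]. Qed.

Lemma smooth_at_mulg (f g : T -> G) x : smooth_at A AG f x ->
  smooth_at A AG g x -> smooth_at A AG (fun y => f y * g y)%g x.
Proof.
have atG := lie_group_atlas; have atGG := is_atlas_prod atG atG.
move=> sf sg; have sfg := smooth_at_pair atA atG atG sf sg.
case: hG => _ /(smooth_mapP _ _ atGG atG)[_ sm] _.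
exact: (smooth_at_comp atA atGG atG sfg (sm _ I)).
Qed.

Lemma smooth_at_invg (f : T -> G) x : smooth_at A AG f x ->
  smooth_at A AG (fun y => (f y)^-1)%g x.
Proof.
have atG := lie_group_atlas => sf.
case: hG => _ _ /(smooth_mapP _ _ atG atG)[_ sm].
exact: (smooth_at_comp atA atG atG sf (sm _ I)).
Qed.

End LieGroup.

(** * The form attached to a splitting *)

Section Splitting.
Context {R : realType} {G : groupType} {Q : Type} {act : G -> Q -> Q}.
Context {AG : atlas R G} {AQ : atlas R Q} {AS : atlas R (orbit_space act)}.
Context (hQ : principal_bundle AG AQ AS).
Context {phi : orbit_space (diag_act act) -> orbit_space (adj_act act)}.
Context (hphi : atiyah_splitting AG AQ phi).
Implicit Types (t : trivialization act) (q : Q) (g k : G).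

Let hG : lie_group AG. Proof. by case: hQ. Qed.
Let atG : is_atlas AG. Proof. exact: lie_group_atlas. Qed.
Let atQ : is_atlas AQ. Proof. by case: hQ => _ [[]]. Qed.
Let atS : is_atlas AS. Proof. by case: hQ => _ [_ []]. Qed.
Let hact : is_action act. Proof. by case: hQ => _ _ []. Qed.
Let hfree : free_action act. Proof. by case: hQ => _ _ []. Qed.
Let act1 q : act 1%g q = q. Proof. by case: hact. Qed.
Let actM g k q : act (g * k)%g q = act g (act k q). Proof. by case: hact. Qed.

Lemma act_triv t x k g : local_trivialization AG AQ AS t -> tdom t x ->
  act k (triv t x g) = triv t x (k * g)%g.
Proof. by case=> _ _ _ + _; exact. Qed.

Lemma tcoord_act t k q : local_trivialization AG AQ AS t ->
  tdom t (cls act q) -> tcoord t (act k q) = (k * tcoord t q)%g.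
Proof.
move=> [_ h1 h2 h3 _] tq; rewrite -{1}(h2 _ tq) h3//.
by have [] := h1 _ (k * tcoord t q)%g tq.
Qed.

Let hdiag : is_action (diag_act act). Proof. exact: diag_act_is_action. Qed.
Let hadj : is_action (adj_act act). Proof. exact: adj_act_is_action. Qed.

Lemma class_set_act (c : orbit_space (adj_act act)) k q g :
  class_set c (q, g) -> class_set c (act k q, (k * g * k^-1)%g).
Proof.
move=> /(class_setP hadj) ->; apply/(class_setP hadj).
by apply/(cls_eqP _ _ hadj); exists k.
Qed.

(** Two such pairs are related by some [k] fixing [q]; freeness makes [k] trivial, and so is the
    conjugation by it. *)
Lemma class_set_inj_fiber (c : orbit_space (adj_act act)) q g g' :
  class_set c (q, g) -> class_set c (q, g') -> g = g'.
Proof.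
move=> /(class_setP hadj) -> /(class_setP hadj)/(cls_eqP _ _ hadj)[k].
by case=> /esym/hfree -> ->; rewrite mul1g invg1 mulg1.
Qed.

(** Any representative lies over the orbit of [q], so some group element carries its first entry to
    [q]. *)
Lemma class_set_fiber (c : orbit_space (adj_act act)) q :
  base_Gtilde c = cls act q -> exists g, class_set c (q, g).
Proof.
rewrite -(class_reprK c); case: (class_repr c) => q' g'.
rewrite base_Gtilde_cls// => /(cls_eqP _ _ hact)[k ->].
by exists (k * g' * k^-1)%g; exists k.
Qed.

Lemma splitting_fiber q0 q1 :
  exists! g, class_set (phi (cls (diag_act act) (q0, q1))) (q0, g).
Proof.
have [g hg] : exists g, class_set (phi (cls (diag_act act) (q0, q1))) (q0, g).
  apply: class_set_fiber; case: hphi => _ -> _; exact: base_QQ_cls.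
by exists g; split=> // g'; exact: class_set_inj_fiber.
Qed.

(** The form is read off in the fibre over [p.1] itself instead of over the unit section of a
    trivialization. This makes it globally defined, so no compatibility between trivializations has
    to be checked. *)
Definition splitting_form (p : Q * Q) : G :=
  projT1 (cid (splitting_fiber p.1 p.2)).

Lemma splitting_formP q0 q1 :
  class_set (phi (cls (diag_act act) (q0, q1))) (q0, splitting_form (q0, q1)).
Proof. by rewrite /splitting_form; case: cid => g []. Qed.

Lemma splitting_formE q0 q1 g :
  class_set (phi (cls (diag_act act) (q0, q1))) (q0, g) ->
  splitting_form (q0, q1) = g.
Proof. exact/class_set_inj_fiber/splitting_formP. Qed.

Lemma cls_triv_shift t0 t1 x0 x1 g0 g1 :
  local_trivialization AG AQ AS t0 -> local_trivialization AG AQ AS t1 ->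
  tdom t0 x0 -> tdom t1 x1 ->
  cls (diag_act act) (triv t0 x0 g0, triv t1 x1 g1) =
  cls (diag_act act) (triv t0 x0 1%g, triv t1 x1 (g0^-1 * g1)%g).
Proof.
move=> h0 h1 tx0 tx1; apply/esym/(cls_eqP _ _ hdiag).
(* Acting by [g0] sends the pair based at the unit to the original pair. *)
exists g0; rewrite /diag_act /= !(act_triv _ _ h0, act_triv _ _ h1)//.
by rewrite mulg1 mulVKg.
Qed.

Lemma in_class_unique t0 t1 x0 x1 g0 g1 :
  local_trivialization AG AQ AS t0 -> local_trivialization AG AQ AS t1 ->
  tdom t0 x0 -> tdom t1 x1 ->
  exists! g, in_class_of_splitting phi t0 t1 x0 x1 g0 g1 g.
Proof.
move=> h0 h1 tx0 tx1; rewrite /in_class_of_splitting.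
rewrite (cls_triv_shift g0 g1 h0 h1)//.
exact: splitting_fiber.
Qed.

(** By [cls_triv_shift] both values come from one class of [Gtilde]. The first is its entry over the
    unit point of the fibre; acting by [g0] moves that point to [triv t0 x0 g0] and conjugates the
    entry. *)
Lemma form_of_splittingP : form_of_splitting AG AQ AS phi splitting_form.
Proof.
move=> t0 t1 x0 x1 g0 g1 g h0 h1 tx0 tx1 hg; split; apply: splitting_formE.
  by rewrite -(cls_triv_shift g0 g1 h0 h1).
have := class_set_act g0 hg.
by rewrite (act_triv _ _ h0)// mulg1.
Qed.

(** Trivializations exist around every base point, so any pair of points can be written in
    coordinates, where the local recipe forces the value. *)
Lemma form_of_splitting_unique Ad :
  form_of_splitting AG AQ AS phi Ad -> Ad = splitting_form.
Proof.
move=> hAd; apply/funext => -[q0 q1]; case: hQ => _ _ _ _ loc.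
have [t0 h0 t0q] := loc (cls act q0); have [t1 h1 t1q] := loc (cls act q1).
have e0 : triv t0 (cls act q0) (tcoord t0 q0) = q0.
  by case: h0 => _ _ + _ _; exact.
have e1 : triv t1 (cls act q1) (tcoord t1 q1) = q1.
  by case: h1 => _ _ + _ _; exact.
have [g [hg _]] := in_class_unique (tcoord t0 q0) (tcoord t1 q1) h0 h1 t0q t1q.
have [_] := hAd _ _ _ _ _ _ _ h0 h1 t0q t1q hg.
have [_] := form_of_splittingP h0 h1 t0q t1q hg.
by rewrite e0 e1 => -> ->.
Qed.

Lemma splitting_form_equivariant k q0 q1 :
  splitting_form (act k q0, act k q1) = (k * splitting_form (q0, q1) * k^-1)%g.
Proof.
apply: splitting_formE.
rewrite (_ : cls _ _ = cls (diag_act act) (q0, q1)).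
  exact/class_set_act/splitting_formP.
by apply/esym/(cls_eqP _ _ hdiag); exists k.
Qed.

Lemma splitting_form_act g q : splitting_form (q, act g q) = g.
Proof.
apply: splitting_formE; rewrite -(atiyah_i_cls _ _ hact).
(* The pair [(q, act g q)] represents the image under [atiyah_i] of the class of [(q, g)], which
   [phi] sends back to that class. *)
case: hphi => _ _ /(congr1 (@^~ (cls (adj_act act) (q, g)))) /= ->.
exact/(class_setP hadj).
Qed.

(** This is the fibre coordinate of the adjoint bundle: moving [q] to the unit point of its fibre by
    the inverse of [tcoord t q] turns [(q, g)] into a pair with this second entry. *)
Definition adj_coord t (p : Q * G) : G :=
  ((tcoord t p.1)^-1 * p.2 * tcoord t p.1)%g.

Lemma adj_coord_adj t k p : local_trivialization AG AQ AS t ->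
  tdom t (cls act p.1) -> adj_coord t (adj_act act k p) = adj_coord t p.
Proof.
move=> ht tp; rewrite /adj_coord /= tcoord_act// invgM !mulgA mulgVK.
by rewrite -!mulgA mulKg.
Qed.

(** By invariance the arbitrary choice made in [class_repr] does not affect the coordinate, which
    thus descends to the quotient. *)
Lemma adj_coord_repr t p : local_trivialization AG AQ AS t ->
  tdom t (cls act p.1) ->
  adj_coord t (class_repr (cls (adj_act act) p)) = adj_coord t p.
Proof.
move=> ht tp.
have [k ->] := (cls_eqP _ _ hadj).1
  (esym (class_reprK (cls (adj_act act) p))).
exact: adj_coord_adj.
Qed.

Let atQG : is_atlas (prod_atlas AQ AG). Proof. exact: is_atlas_prod. Qed.
Let atQQ : is_atlas (prod_atlas AQ AQ). Proof. exact: is_atlas_prod. Qed.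

Lemma smooth_at_tcoord t q : local_trivialization AG AQ AS t ->
  tdom t (cls act q) -> smooth_at AQ AG (tcoord t) q.
Proof.
by move=> [_ _ _ _ [_ /(smooth_mapP _ _ atQ atG)[_ sm]]] tq; exact: sm.
Qed.

Lemma mopen_over t : local_trivialization AG AQ AS t ->
  mopen AQ (cls act @^-1` tdom t).
Proof. by move=> [_ _ _ _ [_ /(smooth_mapP _ _ atQ atG)[]]]. Qed.

Lemma mopen_over_fst {T} {B : atlas R T} t : is_atlas B ->
  local_trivialization AG AQ AS t ->
  mopen (prod_atlas AQ B) [set p | tdom t (cls act p.1)].
Proof.
move=> atB ht; have atP := is_atlas_prod atQ atB.
have [/(_ _ (mopen_over ht)) + _] : smooth_map (prod_atlas AQ B) AQ setT fst.
  apply/smooth_mapP => //; split; first exact: mopenT.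
  by move=> p _; exact: smooth_at_fst.
by rewrite setTI.
Qed.

Lemma smooth_adj_coord t : local_trivialization AG AQ AS t ->
  smooth_map (prod_atlas AQ AG) AG [set p | tdom t (cls act p.1)] (adj_coord t).
Proof.
move=> ht; apply/smooth_mapP => //; split; first exact: mopen_over_fst.
move=> p tp.
have st : smooth_at (prod_atlas AQ AG) AG (fun p => tcoord t p.1) p.
  apply: (smooth_at_comp atQG atQ atG); first exact: smooth_at_fst.
  exact: smooth_at_tcoord.
apply: (smooth_at_mulg hG atQG) => //; apply: (smooth_at_mulg hG atQG).
  exact: (smooth_at_invg hG atQG).
exact: smooth_at_snd.
Qed.

(** Smoothness of [phi] is expressed through real functions on quotients, so the group-valued
    coordinate is tested through its components in a chart [d] of [G], and reassembled by
    [Ck_coordP]. *)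
Lemma smooth_at_adj_coord_splitting t p : local_trivialization AG AQ AS t ->
  tdom t (cls act p.1) ->
  smooth_at (prod_atlas AQ AQ) AG
    (fun p => adj_coord t (class_repr (phi (cls (diag_act act) p)))) p.
Proof.
move=> ht tp; set B := fun p => _.
have [d Ad dBp] := chart_exists atG (B p).
have [c Qc cp] := chart_exists atQQ p.
(* [W] is the part of [Gtilde] where the coordinate is available and falls in the chart [d]; its
   pullback to [Q * G] is open by [WE]. *)
pose W : set (orbit_space (adj_act act)) :=
  [set a | tdom t (base_Gtilde a) /\ cdom d (adj_coord t (class_repr a))].
have [tcont tsm] := smooth_adj_coord ht.
have WE : cls (adj_act act) @^-1` W =
    [set p | tdom t (cls act p.1)] `&` adj_coord t @^-1` cdom d.
  apply/seteqP; split=> -[q g]; rewrite /W /= base_Gtilde_cls// => -[tq].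
    by rewrite adj_coord_repr.
  by split=> //; rewrite adj_coord_repr.
have oW : quot_open (prod_atlas AQ AG) W.
  by rewrite /quot_open WE; apply/tcont/(mopen_cdom atG).
pose u j (a : orbit_space (adj_act act)) : R :=
  cmap d (adj_coord t (class_repr a)) 0 j.
have su j : quot_smooth_fun (prod_atlas AQ AG) W (u j).
  move=> e He k; have := oW e He; rewrite WE setIA => oD.
  have /(Ck_coordP _ _ oD)/(_ j) := tsm e d He Ad k.
  apply: Ck_ext => // _ /set_mem[y [[ey ty] dy] <-].
  by rewrite /u /= (chartK atQG)// adj_coord_repr.
case: hphi => sphi bphi _.
have {sphi} [oV sV] := sphi W oW.
exists c, d; split=> //.
exists (cdom c `&` cls (diag_act act) @^-1` (phi @^-1` W)); split=> //.
- by apply: (mopenI atQQ) => //; exact: (mopen_cdom atQQ).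
(* Since [phi] covers the identity of the base, the class it assigns to [p] still lies over
   [tdom t]. *)
- split=> //; split=> //=; rewrite bphi.
  by case: (p) tp => q0 q1; rewrite base_QQ_cls.
- by move=> y [_ []].
- move=> k; apply/Ck_coordP => [|j]; last exact: (sV (u j) (su j) c Qc k).
  exact: oV.
Qed.

Lemma smooth_splitting_form :
  smooth_map (prod_atlas AQ AQ) AG setT splitting_form.
Proof.
apply/(smooth_mapP _ _ atQQ atG); split; first exact: mopenT.
move=> p _; case: hQ => _ _ _ _ /(_ (cls act p.1))[t ht tp].
pose f (p : Q * Q) := tcoord t p.1.
pose h p := adj_coord t (class_repr (phi (cls (diag_act act) p))).
have sf : smooth_at (prod_atlas AQ AQ) AG f p.
  apply: (smooth_at_comp atQQ atQ atG); first exact: smooth_at_fst.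
  exact: smooth_at_tcoord.
have sh : smooth_at (prod_atlas AQ AQ) AG h p.
  exact: smooth_at_adj_coord_splitting.
(* Conjugating [h] back by [f] recovers the form over [tdom t], an open condition on the first
   point, which suffices for smoothness at [p]. *)
apply: (@smooth_at_ext _ _ _ _ _ [set p | tdom t (cls act p.1)]
  (fun p => f p * h p * (f p)^-1)%g) => //; first exact: mopen_over_fst.
- move=> [q0 q1] /= tq; rewrite /h.
  have /(class_setP hadj) -> := splitting_formP q0 q1.
  by rewrite adj_coord_repr// /f /adj_coord /= !mulgA mulgV mul1g mulgK.
- apply: (smooth_at_mulg hG atQQ); last exact: (smooth_at_invg hG atQQ).
  exact: (smooth_at_mulg hG atQQ).
Qed.

End Splitting.

(** The first clause makes the local recipe meaningful. As [form_of_splitting] ranges over all pairs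
    of trivializations, the existence of [Ad] contains its independence of those chosen, and its
    uniqueness turns the recipe into a definition. *)
Theorem lemma4p10 (R : realType) (G : groupType) (Q : Type) (act : G -> Q -> Q)
    (AG : atlas R G) (AQ : atlas R Q) (AS : atlas R (orbit_space act))
    (hQ : principal_bundle AG AQ AS)
    (phi : orbit_space (diag_act act) -> orbit_space (adj_act act))
    (hphi : atiyah_splitting AG AQ phi) :
  (forall t0 t1 x0 x1 g0 g1,
     local_trivialization AG AQ AS t0 -> local_trivialization AG AQ AS t1 ->
     tdom t0 x0 -> tdom t1 x1 ->
     cls (diag_act act) (triv t0 x0 g0, triv t1 x1 g1) =
       cls (diag_act act) (triv t0 x0 1%g, triv t1 x1 (g0^-1 * g1)%g) /\
     exists! g, in_class_of_splitting phi t0 t1 x0 x1 g0 g1 g) /\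
  (exists! Ad : Q * Q -> G, form_of_splitting AG AQ AS phi Ad) /\
  (forall Ad : Q * Q -> G, form_of_splitting AG AQ AS phi Ad ->
     discrete_connection_form act AG AQ Ad).
Proof.
split; [|split].
- move=> t0 t1 x0 x1 g0 g1 h0 h1 tx0 tx1; split.
    exact: (cls_triv_shift hQ).
  exact: (in_class_unique hQ hphi).
- exists (splitting_form hQ hphi); split; first exact: form_of_splittingP.
  by move=> Ad /(form_of_splitting_unique hQ hphi).
move=> Ad /(form_of_splitting_unique hQ hphi) ->; split.
- exact: smooth_splitting_form.
- exact: splitting_form_equivariant.
- exact: splitting_form_act.
Qed.
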